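(* Let $T$ and $T'$ be finite trees, each having a single centroid, and let $f:E(T)\to E(T')$ be a bijection such that $\theta_{T'}(\{f(e),f(e')\})=\theta_T(\{e,e'\})$ for all distinct edges $e,e'\in E(T)$. Then $T$ and $T'$ are isomorphic. In other words, a tree with a single centroid is uniquely determined by the data $\theta_T(\{e_i,e_k\})$ for all distinct edges $e_i,e_k$.
   Context: For a finite tree $T$ and a set $S\subseteq E(T)$, $\theta_T(S)$ is the partition of $\#V(T)$ whose parts are the numbers of vertices of the connected components of the graph $(V(T),E(T)\setminus S)$. The weight of a vertex $v$ of $T$ is the maximal number of edges in any subtree of $T$ containing $v$ as a leaf; the centroid of $T$ is the set of vertices of minimum weight, and $T$ has a single centroid if this set has exactly one element. *)

(* Defs.v *)
From mathcomp Require Import all_boot.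
Set Implicit Arguments.
Unset Strict Implicit.
Unset Printing Implicit Defensive.

Record sgraph := SGraph {
  vertex :> finType;
  adj : rel vertex;
  adj_sym : symmetric adj;
  adj_irrefl : irreflexive adj
}.

Section FiniteRelations.
Variables (V : finType) (r : rel V).

(* Bounding the length of a cycle by #|V| loses nothing (see acyclicP) and
   makes the predicate boolean.  Length > 2 excludes x - y - x. *)
Definition acyclic : bool :=
  [forall n : 'I_#|V|.+1, forall c : n.-tuple V, (2 < n) ==> ~~ ucycleb r c].

Lemma acyclicP :
  reflect (forall c : seq V, 2 < size c -> ~ ucycle r c) acyclic.
Proof.
apply: (iffP forallP) => [ac c c_gt2 cyc | ac n].
  have /andP[_ /card_uniqP c_uniq] := cyc.
  have c_le : size c < #|V|.+1 by rewrite ltnS -c_uniq max_card.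
  have /forallP/(_ (in_tuple c)) := ac (Ordinal c_le).
  by rewrite /= c_gt2 /= => /negP; apply.
apply/forallP => c; apply/implyP => n_gt2; apply/negP; apply: ac.
by rewrite size_tuple.
Qed.

(* The graph with vertex set W and adjacency r is a tree; to be used only when
   r relates elements of W, so that r-paths and r-cycles stay inside W. *)
Definition tree_on (W : {set V}) : bool :=
  [&& W != set0, [forall x in W, forall y in W, connect r x y] & acyclic].

Definition components : {set {set V}} :=
  equivalence_partition (connect r) [set: V].

End FiniteRelations.

Definition edge_set (G : sgraph) : {set {set G}} :=
  [set [set p.1; p.2] | p : G * G & adj p.1 p.2].

Notation edge G := {a : {set (vertex G)} | a \in edge_set G}.

Section Trees.
Variable G : sgraph.
Implicit Types (v : G) (W : {set G}) (F S : {set edge G}).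

Definition edge_rel F : rel G :=
  [rel x y | [exists a in F, val a == [set x; y]]].

Definition is_tree : bool := tree_on (@adj G) [set: G].

(* Partitions of an integer are nonincreasing sequences of positive integers. *)
Definition theta S : seq nat :=
  sort geq [seq #|C| | C : {set G} in components (edge_rel (~: S))].

Definition subtree W F : bool :=
  [forall a in F, val a \subset W] && tree_on (edge_rel F) W.

Definition leaf W F v : bool :=
  (v \in W) && (#|[set a in F | v \in val a]| == 1).

(* The maximum of the empty family is 0: this concerns only the one-vertex
   tree, whose vertex is thus its single centroid. *)
Definition weight v : nat :=
  \max_(H : {set G} * {set edge G} | subtree H.1 H.2 && leaf H.1 H.2 v) #|H.2|.

Definition centroid : {set G} := [set v | [forall u, weight v <= weight u]].

Definition single_centroid : Prop := #|centroid| = 1.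

End Trees.

Definition isomorphic (G G' : sgraph) : Prop :=
  exists2 h : G -> G', bijective h & {mono h : x y / adj x y}.

(* Main.v *)
(* Root each tree at its centroid [c], and let [cut c a] be the set of vertices
   separated from [c] by the edge [a].  These sets are nested or disjoint, the
   lower endpoints of the edges are the vertices other than [c], and two
   vertices are adjacent iff exactly one edge separates them.  The centroid
   being single, each [cut c a] has fewer than half of the n vertices, so for
   k < n / 2 the partition theta {a, b} has a part n - k iff
   [cut c a :|: cut c b] has k elements.  These data determine the pendant
   edges (those that form a union of size 2 with at least two other edges), then
   the sizes of all [cut c a] (pair [a] with a pendant edge beyond it), then
   their inclusions ([cut c a] is contained in [cut c b] iff the union has the
   size of [cut c b]), hence the tree. *)
Require Import Defs.
From mathcomp Require Import all_boot zify.
Set Implicit Arguments.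
Unset Strict Implicit.
Unset Printing Implicit Defensive.

Lemma ex_notin (V : finType) (A : {set V}) :
  #|A| < #|V| -> exists x, x \notin A.
Proof.
move=> cA; apply/existsP; rewrite -negb_forall.
apply: contraTN cA => /forallP AT; rewrite -leqNgt.
exact/subset_leq_card/subsetP.
Qed.

Lemma subset_cardsU (V : finType) (A B : {set V}) :
  (A \subset B) = (#|A :|: B| == #|B|).
Proof.
apply/setUidPr/eqP => [-> //|AB]; apply/esym/eqP.
by rewrite eqEcard subsetUr AB leqnn.
Qed.

(** * Connectivity after the deletion of edges *)

Section EdgeRelation.
Variable G : sgraph.
Implicit Types (x y z : G) (a b : edge G) (F S : {set edge G}).

Lemma edge_relP F x y :
  reflect (exists2 a, a \in F & val a = [set x; y]) (edge_rel F x y).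
Proof.
apply: (iffP existsP) => [[a /andP[aF /eqP Ea]]|[a aF Ea]]; exists a => //.
by rewrite aF Ea eqxx.
Qed.

Lemma edge_rel_sym F : symmetric (edge_rel F).
Proof. by move=> x y; apply: eq_existsb => a; rewrite setUC. Qed.

Lemma connect_edge_rel_sym F : connect_sym (edge_rel F).
Proof. exact/sym_connect_sym/edge_rel_sym. Qed.

Lemma edge_endsP a : exists x y, adj x y /\ val a = [set x; y].
Proof.
have /imsetP[[x y]] := valP a; rewrite inE /= => xy Ea.
by exists x, y.
Qed.

Lemma adj_edge x y : adj x y -> exists a : edge G, val a = [set x; y].
Proof.
move=> xy; have Pe : [set x; y] \in edge_set G.
  by apply/imsetP; exists (x, y); rewrite ?inE.
by exists (Sub [set x; y] Pe).
Qed.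

Lemma edge_adj a x y : val a = [set x; y] -> adj x y.
Proof.
have [u [w [uw ->]]] := edge_endsP a => E.
have uNw : u != w by apply: contraTneq uw => ->; rewrite adj_irrefl.
have : x \in [set u; w] by rewrite E !inE eqxx.
have : y \in [set u; w] by rewrite E !inE eqxx orbT.
have: #|[set x; y]| == 2 by rewrite -E cards2 uNw.
rewrite cards2 !inE => xNy /orP[]/eqP Ey /orP[]/eqP Ex; move: xNy uw;
  by rewrite Ex Ey ?eqxx // adj_sym.
Qed.

Lemma edge_relT : edge_rel [set: edge G] =2 @adj G.
Proof.
move=> x y; apply/edge_relP/idP => [[a _ /edge_adj] //|/adj_edge[a Ea]].
by exists a.
Qed.

Lemma edge_relS F F' : F \subset F' -> subrel (edge_rel F) (edge_rel F').
Proof.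
by move=> /subsetP sF x y /edge_relP[a aF Ea]; apply/edge_relP; exists a; auto.
Qed.

Lemma connect_edge_relS F F' : F \subset F' ->
  subrel (connect (edge_rel F)) (connect (edge_rel F')).
Proof.
by move=> sF; apply: connect_sub => x y /(edge_relS sF); apply: connect1.
Qed.

(** Induction along a path: only a step across [a] changes the case, and two crossings in opposite
    directions cancel. *)
Lemma connect_del_edge F a u w x y : val a = [set u; w] ->
  connect (edge_rel F) x y ->
  let e := edge_rel (F :\ a) in
  [\/ connect e x y, connect e x u /\ connect e w y
    | connect e x w /\ connect e u y].
Proof.
move=> Ea /connectP[p]; elim: p x => [|z p IH] x /=.
  by move=> _ ->; constructor 1.
case/andP=> /edge_relP[b bF Eb] /IH{}IH /IH{IH} /= IH.
have [Eab|bNa] := eqVneq b a.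
  have : x \in val a by rewrite -Eab Eb !inE eqxx.
  have : z \in val a by rewrite -Eab Eb !inE eqxx orbT.
  have xNz : x != z.
    by apply: contraTneq (edge_adj Eb) => ->; rewrite adj_irrefl.
  rewrite Ea !inE => /orP[]/eqP Ez /orP[]/eqP Ex; subst.
  - by rewrite eqxx in xNz.
  - by case: IH => [c|[_ c]|[_ c]]; [constructor 3|constructor 1|constructor 3].
  - by case: IH => [c|[_ c]|[_ c]]; [constructor 2|constructor 2|constructor 1].
  - by rewrite eqxx in xNz.
have xz : connect (edge_rel (F :\ a)) x z.
  by apply/connect1/edge_relP; exists b => //; rewrite !inE bNa.
case: IH => [c|[c d]|[c d]]; [constructor 1|constructor 2|constructor 3];
  by rewrite ?(connect_trans xz c) ?d.
Qed.

End EdgeRelation.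

(** * The two sides of an edge of a tree *)

Section Tree.
Variables (G : sgraph) (treeG : is_tree G).
Implicit Types (r x y z : G) (a b : edge G) (F S : {set edge G}).

Local Opaque is_tree.

Lemma tree_connect x y : connect (edge_rel [set: edge G]) x y.
Proof.
rewrite (eq_connect (@edge_relT G)); have /and3P[_ c _] := treeG.
by move/forall_inP/(_ x (in_setT _))/forall_inP/(_ y (in_setT _)): c.
Qed.

Lemma tree_edge_bridge a u w : val a = [set u; w] ->
  ~~ connect (edge_rel (~: [set a])) u w.
Proof.
move=> Ea; apply/negP => /connectP[p pth Ew].
case/shortenP: pth Ew => q qpth quniq _ Ew.
have uNw : u != w by apply: contraTneq (edge_adj Ea) => ->; rewrite adj_irrefl.
have /and3P[_ _ /acyclicP] := treeG; move=> /(_ (u :: q)); apply.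
  (* A path of one edge would be [a] itself, since an edge is determined by its ends; hence the
     cycle closed by [a] has length at least 3. *)
  case: q qpth quniq Ew => [|z [|z' q]] //= => [_ _ E|].
    by rewrite E eqxx in uNw.
  rewrite andbT => /edge_relP[b bS Eb] _ E; rewrite -E in Eb.
  by move: bS; rewrite !inE => /eqP[]; apply/val_inj; rewrite Ea Eb.
rewrite /ucycle /ucycleb quniq andbT /= rcons_path -Ew adj_sym (edge_adj Ea).
rewrite andbT; apply: sub_path qpth => x y /(edge_relS (subsetT _)).
by rewrite edge_relT.
Qed.

(* The side of [a] away from [r]. *)
Definition cut r a : {set G} :=
  locked [set x | ~~ connect (edge_rel (~: [set a])) r x].

Lemma in_cut r a x :
  (x \in cut r a) = ~~ connect (edge_rel (~: [set a])) r x.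
Proof. by rewrite /cut -lock in_set. Qed.

Lemma root_cut r a : r \notin cut r a.
Proof. by rewrite in_cut negbK connect0. Qed.

Lemma cut_neq_root r a x : x \in cut r a -> x != r.
Proof. by apply: contraTneq => ->; apply: root_cut. Qed.

Lemma cut_connect r S x y a : connect (edge_rel (~: S)) x y -> a \in S ->
  (x \in cut r a) = (y \in cut r a).
Proof.
move=> xy aS; rewrite !in_cut; congr (~~ _).
apply: (same_connect_r (connect_edge_rel_sym _)).
by apply: connect_edge_relS xy; rewrite setCS sub1set.
Qed.

Lemma cut_edge r a u w : val a = [set u; w] ->
  (u \in cut r a) = (w \notin cut r a).
Proof.
move=> Ea; rewrite !in_cut negbK; apply/idP/idP => [ru|rw].
  have := connect_del_edge Ea (tree_connect r u).
  rewrite setTD => -[c|[c _]|[c _]] //; by rewrite c in ru.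
apply: contra (tree_edge_bridge Ea) => ru.
by apply: connect_trans rw; rewrite connect_edge_rel_sym.
Qed.

Lemma cut_other_edge r a b u w : val b = [set u; w] -> a != b ->
  (u \in cut r a) = (w \in cut r a).
Proof.
move=> Eb aNb; apply: (@cut_connect r [set a]); last exact: set11.
by apply/connect1/edge_relP; exists b; rewrite // !inE eq_sym.
Qed.

(* The root only serves to name one of the two sides of each edge. *)
Lemma connect_cut r S x y :
  connect (edge_rel (~: S)) x y =
  [forall a in S, (x \in cut r a) == (y \in cut r a)].
Proof.
apply/idP/forall_inP => [xy a aS|]; first exact/eqP/cut_connect/aS.
elim: {S}#|S| {-2}S (erefl #|S|) => [|m IH] S.
  by move/eqP; rewrite cards_eq0 => /eqP-> _; rewrite setC0 tree_connect.
move=> cardS; have /card_gt0P[a aS] : 0 < #|S| by rewrite cardS.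
rewrite -(setD1K aS); set S' := S :\ a => sep.
have {}IH : connect (edge_rel (~: S')) x y.
  apply: IH => [|b bS]; last by apply: sep; rewrite in_setU1 bS orbT.
  by apply/eqP; rewrite -eqSS -cardS (cardsD1 a S) aS.
have [u [w [_ Ea]]] := edge_endsP a.
have ES : ~: S' :\ a = ~: (a |: S') by apply/setP => b; rewrite !inE negb_or.
have /eqP same := sep a (setU11 _ _).
have uw := cut_edge r Ea.
(* If deleting [a] disconnected [x] from [y], they would be joined to different ends of [a], which
   lie on opposite sides, against [same]. *)
have := connect_del_edge Ea IH; rewrite ES.
have side := fun s t => @cut_connect r (a |: S') s t a ^~ (setU11 a S').
case=> [//|[/side Ex /side Ey]|[/side Ex /side Ey]]; exfalso; move: uw;
  by rewrite -?Ex ?Ey same -?Ex -?Ey ?same; case: (_ \in _).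
Qed.

Lemma cut_inj r x y : (forall a, (x \in cut r a) = (y \in cut r a)) -> x = y.
Proof.
move=> sep; have : connect (edge_rel (~: setT)) x y.
  by rewrite (connect_cut r); apply/forall_inP => a _; rewrite sep.
case/connectP => -[|z p] //= /andP[/edge_relP[a]].
by rewrite setCT inE.
Qed.

Lemma adj_cut r x y :
  adj x y = (#|[set a | (x \in cut r a) != (y \in cut r a)]| == 1).
Proof.
apply/idP/cards1P => [/adj_edge[a Ea]|[a Da]].
  exists a; apply/setP => b; rewrite [LHS]in_set in_set1.
  have [->|bNa] := eqVneq b a.
    by rewrite (cut_edge r Ea); case: (_ \in _).
  by rewrite (cut_other_edge r Ea bNa) eqxx.
(* Keep [a] alone and delete all other edges: none of these separates [x] from [y], so the two are
   still connected, and both must be ends of [a]. *)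
have : connect (edge_rel (~: (~: [set a]))) x y.
  rewrite (connect_cut r); apply/forall_inP => b; rewrite in_setC -Da in_set.
  by rewrite negbK.
have xNy : x != y.
  have : a \in [set a] by exact: set11.
  by rewrite -Da in_set; apply: contraNneq => ->.
rewrite setCK => c; have E b : b \in [set a] -> b = a by move/set1P.
have xa : x \in val a.
  case/connectP: (c) xNy => -[|z p] /=; first by move=> _ ->; rewrite eqxx.
  by case/andP=> /edge_relP[b /E-> ->]; rewrite !inE eqxx.
have ya : y \in val a.
  rewrite connect_edge_rel_sym in c.
  case/connectP: (c) xNy => -[|z p] /=; first by move=> _ ->; rewrite eqxx.
  by case/andP=> /edge_relP[b /E-> ->]; rewrite !inE eqxx.
have [u [w [uw Ea]]] := edge_endsP a.
move: xa ya xNy; rewrite Ea !inE => /orP[]/eqP-> /orP[]/eqP->; rewrite ?eqxx //.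
by rewrite adj_sym.
Qed.

(** * Lower endpoints and the nesting of cuts *)

(* The endpoint of [a] away from [r]; the default [r] never occurs. *)
Definition low r a : G :=
  locked (odflt r [pick x in val a | x \in cut r a]).

Lemma lowP r a : exists2 u, u \notin cut r a &
  (low r a \in cut r a) /\ val a = [set u; low r a].
Proof.
rewrite /low -lock; case: pickP => [w /andP[wa wD]|none].
  have [u [v [_ Ea]]] := edge_endsP a; have uv := cut_edge r Ea.
  have : w \in [set u; v] by rewrite -Ea.
  case/set2P => Ew.
  - by subst w; exists v; [rewrite -uv | rewrite Ea setUC].
  - by subst w; exists u; [rewrite uv wD | rewrite Ea].
have [u [v [_ Ea]]] := edge_endsP a; have uv := cut_edge r Ea.
move: (none u) (none v); rewrite Ea set21 set22 /= uv.
by move=> /negbT/negPn->.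
Qed.

Lemma low_cut r a : low r a \in cut r a.
Proof. by have [u _ []] := lowP r a. Qed.

Lemma edge_other_cut r a b x : a != b -> x \in val b ->
  (x \in cut r a) = (low r b \in cut r a).
Proof.
have [u _ [_ Eb]] := lowP r b => ab.
by rewrite Eb inE => /orP[]/set1P->; rewrite // (cut_other_edge r Eb ab).
Qed.

Lemma low_edge r a : low r a \in val a.
Proof. by have [u _ [_ ->]] := lowP r a; rewrite !inE eqxx orbT. Qed.

Lemma tree_closed r (P : pred G) : P r ->
  (forall b x y, val b = [set x; y] -> P x -> P y) -> forall x, P x.
Proof.
move=> Pr Pcl x; have /connectP[p] := tree_connect r x.
elim: p r Pr => [|z p IH] r Pr /=; first by move=> _ ->.
by case/andP => /edge_relP[b _ /Pcl/(_ Pr)]; apply: IH.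
Qed.

(** Otherwise both ends of [a] lie in [cut r b] and both ends of [b] in [cut r a], so no edge leaves
    the set of vertices outside both cuts, which contains [r]. *)
Lemma low_cut_asym r a b : a != b -> low r a \in cut r b ->
  low r b \notin cut r a.
Proof.
move=> aNb ab; apply/negP => ba.
suff /(_ (low r a)): forall x, (x \notin cut r a) && (x \notin cut r b).
  by rewrite low_cut.
apply: (@tree_closed r); first by rewrite !root_cut.
move=> e x y Ee /andP[xa xb].
have [xe ye] : x \in val e /\ y \in val e by rewrite Ee !inE !eqxx orbT.
have [Ea|eNa] := eqVneq a e.
  by move: xb; rewrite (@edge_other_cut r b a) -?Ea ?ab // ?Ea // -Ea eq_sym.
have [Eb|eNb] := eqVneq b e.
  by move: xa; rewrite (@edge_other_cut r a b) ?ba // Eb.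
by rewrite -(cut_other_edge r Ee eNa) -(cut_other_edge r Ee eNb) xa.
Qed.

(** Membership in [cut r a] implies membership in [cut r b] at [r], and every edge preserves this:
    both ends of [a] lie in [cut r b], both ends of [b] outside [cut r a]. *)
Lemma low_cut_sub r a b : low r a \in cut r b -> cut r a \subset cut r b.
Proof.
have [-> //|aNb] := eqVneq a b.
move=> ab; have ba := low_cut_asym aNb ab; apply/subsetP => x.
apply/implyP; move: x; apply: (@tree_closed r).
  by rewrite (negPf (root_cut _ _)).
move=> e x y Ee Px.
have [xe ye] : x \in val e /\ y \in val e by rewrite Ee !inE !eqxx orbT.
have [Ea|eNa] := eqVneq a e.
  by subst e; rewrite (@edge_other_cut r b a) ?ab ?implybT // eq_sym.
have [Eb|eNb] := eqVneq b e.
  by subst e; rewrite (@edge_other_cut r a b) // (negPf ba).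
by rewrite -(cut_other_edge r Ee eNa) -(cut_other_edge r Ee eNb).
Qed.

Lemma cut_disjoint r a b : low r a \notin cut r b -> low r b \notin cut r a ->
  [disjoint cut r a & cut r b].
Proof.
move=> ab ba; have aNb : a != b by apply: contraNneq ab => ->; rewrite low_cut.
rewrite disjoints_subset; apply/subsetP => x; rewrite in_setC.
apply/implyP; move: x; apply: (@tree_closed r).
  by rewrite (negPf (root_cut _ _)).
move=> e x y Ee Px.
have [xe ye] : x \in val e /\ y \in val e by rewrite Ee !inE !eqxx orbT.
have [Ea|eNa] := eqVneq a e.
  by subst e; rewrite (@edge_other_cut r b a) ?ab ?implybT // eq_sym.
have [Eb|eNb] := eqVneq b e.
  by subst e; rewrite (@edge_other_cut r a b) // (negPf ba).
by rewrite -(cut_other_edge r Ee eNa) -(cut_other_edge r Ee eNb).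
Qed.

Lemma cut_laminar r a b x : x \in cut r a -> x \in cut r b ->
  (low r a \in cut r b) || (low r b \in cut r a).
Proof.
move=> xa xb; apply: contraTT xb; rewrite negb_or => /andP[ab ba].
by have /disjointFr-> := cut_disjoint ab ba.
Qed.

Lemma low_cutE r a b : (low r a \in cut r b) = (cut r a \subset cut r b).
Proof.
by apply/idP/idP => [/low_cut_sub //|/subsetP->]; rewrite ?low_cut.
Qed.

Lemma low_inj r : injective (low r).
Proof.
move=> a b E; apply: contraTeq (low_cut r a) => aNb.
by rewrite {1}E; apply: low_cut_asym aNb _; rewrite E; apply: low_cut.
Qed.

(** Take the smallest cut containing [x]: by laminarity its lower end lies in the same cuts as [x],
    hence equals [x]. *)
Lemma low_surj r x : x != r -> exists a, x = low r a.
Proof.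
move=> xNr; have [a0 xa0] : exists a, x \in cut r a.
  apply/existsP; apply: contraNT xNr => /existsPn xD; apply/eqP.
  by apply: (@cut_inj r) => a; rewrite (negPf (xD a)) (negPf (root_cut _ _)).
pose Q := [pred a | x \in cut r a].
case: (@arg_minnP _ a0 Q (fun a => #|cut r a|) xa0) => a /= xa amin.
exists a; apply: (@cut_inj r) => b; apply/idP/idP => [xb|ab]; last first.
  by have /subsetP := low_cut_sub ab; apply.
case/orP: (cut_laminar xa xb) => [ab|ba]; first exact: ab.
apply: contraT => ab.
have := amin b xb; rewrite leqNgt => /negP[]; apply: proper_card.
by rewrite properE low_cut_sub //= -low_cutE.
Qed.

(** [low r] is a bijection from the edges onto the vertices other than [r]. *)
Lemma card_tree : #|G| = #|{: edge G}|.+1.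
Proof.
have [r] : exists r : G, True.
  by have /and3P[/set0Pn[r _] _ _] := treeG; exists r.
move=> _; rewrite -(card_codom (@low_inj r)) -(cardC (pred1 r)) card1 add1n.
congr _.+1; apply: eq_card => x; rewrite !inE.
apply/idP/codomP => [/low_surj //|[a ->]].
exact: cut_neq_root (low_cut r a).
Qed.

Lemma cut_gt0 r a : 0 < #|cut r a|.
Proof. by apply/card_gt0P; exists (low r a); apply: low_cut. Qed.

Lemma low_root r a : low r a != r.
Proof. exact: cut_neq_root (low_cut r a). Qed.

Lemma root_edge r a : r \in val a -> val a = [set r; low r a].
Proof.
have [u uN [lD Ea]] := lowP r a; rewrite Ea => /set2P[-> //|E].
by have := low_root r a; rewrite -E eqxx.
Qed.

(** * Weights and the single centroid *)

Lemma cut_flip a u w : val a = [set u; w] -> cut w a = ~: cut u a.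
Proof.
move=> Ea; have wu : w \in cut u a.
  by have := cut_edge u Ea; rewrite (negPf (root_cut _ _)) => /esym/negbFE.
apply/setP => x; rewrite in_cut in_setC (connect_cut u); congr (~~ _).
apply/forall_inP/idP => [/(_ a (set11 _))|xu b /set1P->]; rewrite wu.
  by move/eqP <-.
by rewrite xu.
Qed.

(* The edges of a subtree with leaf [x] inject, by [low x], into the side away
   from [x] of its edge at [x]. *)
Lemma weight_le x m :
  (forall a, x \in val a -> #|cut x a| <= m) -> weight x <= m.
Proof.
move=> le_m; apply/bigmax_leqP => -[W F] /=.
case/andP=> /andP[/forall_inP FW /and3P[_ /forall_inP cW _]].
case/andP=> xW /cards1P[a /setP Da].
have xa : x \in val a.
  by have := Da a; rewrite in_set set11 => /andP[].
have {}Da b : b \in F -> x \in val b -> b = a.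
  by move=> bF xb; have := Da b; rewrite in_set in_set1 bF xb => /esym/eqP.
apply: leq_trans (le_m a xa); rewrite -(card_imset _ (@low_inj x)).
(* As [a] is the only edge of [F] at [x], no edge of [F] leaves the branch at [x] through [a]. *)
have closedF : closed (edge_rel F) (x |: cut x a).
  apply: (intro_closed (connect_edge_rel_sym F)) => y z /edge_relP[b bF Eb].
  have [Eba|bNa] := eqVneq b a.
    have : z \in val a by rewrite -Eba Eb set22.
    rewrite (root_edge xa) => /set2P[]-> _; first exact: setU11.
    by rewrite in_setU1 low_cut orbT.
  rewrite !in_setU1 => /predU1P[yx|yc].
    by case/eqP: bNa; apply: Da; rewrite // Eb yx set21.
  by rewrite -(cut_other_edge x Eb) ?yc ?orbT // eq_sym.
apply: subset_leq_card; apply/subsetP => _ /imsetP[b bF ->].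
have lW : low x b \in W by apply: (subsetP (FW b bF)); apply: low_edge.
have /forall_inP/(_ _ lW) := cW x xW.
move/(closed_connect closedF); rewrite setU11 in_setU1 (negPf (low_root _ _)).
by move/esym.
Qed.

(** The branch at [r] through [a], together with [r], is a subtree with leaf [r], and its edges
    reach every vertex of [cut r a] as a lower end. *)
Lemma weight_ge r a : r \in val a -> #|cut r a| <= weight r.
Proof.
move=> ra; pose W := r |: cut r a.
pose F : {set edge G} := [set b : edge G | val b \subset W].
have aF : a \in F.
  rewrite in_set (root_edge ra); apply/subsetP => x /set2P[]->.
    exact: setU11.
  by rewrite in_setU1 low_cut orbT.
have belowF b : low r b \in cut r a -> b \in F.
  move=> bc; have [-> //|bNa] := eqVneq b a.
  rewrite in_set; apply/subsetP => x xb; rewrite in_setU1.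
  by rewrite (@edge_other_cut r a b x) ?bc ?orbT // eq_sym.
suff ok : subtree W F && leaf W F r.
  apply: (@leq_trans #|F|); last first.
    pose P (H : {set G} * {set edge G}) := subtree H.1 H.2 && leaf H.1 H.2 r.
    exact: (@leq_bigmax_cond _ P (fun H => #|H.2|) (W, F) ok).
  apply: leq_trans (leq_imset_card (low r) (mem F)).
  apply/subset_leq_card/subsetP => x xc.
  have xNr := cut_neq_root xc.
  have [b Ex] := low_surj xNr; rewrite Ex in xc *.
  by apply: imset_f; apply: belowF.
have rW x : x \in W -> connect (edge_rel F) r x.
  case/setU1P => [-> //|xc]; rewrite -(setCK F) (connect_cut r).
  apply/forall_inP => b; rewrite in_setC => bF.
  (* An edge [b] outside [F] that separates [r] from [x] would be nested with [a]: below [a] it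
     belongs to [F], above [a] it puts [r] in its own cut. *)
  rewrite (negPf (root_cut _ _)) eq_sym eqbF_neg; apply/negP => xb.
  have aNb : b != a by apply: contraNneq bF => ->.
  case/orP: (cut_laminar xc xb) => [ab|/belowF]; last exact/negP.
  have := root_cut r b; rewrite (edge_other_cut r aNb ra).
  by rewrite ab.
apply/andP; split; last first.
  rewrite /leaf setU11 /=; apply/cards1P; exists a; apply/setP => b.
  rewrite in_set in_set1; apply/andP/eqP => [[bF rb]|-> //].
  apply: contraTeq bF => bNa; rewrite in_set (root_edge rb).
  apply/subsetP => /(_ _ (set22 _ _)).
  rewrite in_setU1 (negPf (low_root _ _)) /=.
  by rewrite -(@edge_other_cut r a b r) ?(negPf (root_cut _ _)) // eq_sym.
apply/andP; split; first by apply/forall_inP => b; rewrite in_set.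
apply/and3P; split.
- by apply/set0Pn; exists r; rewrite setU11.
- apply/forall_inP => x xW; apply/forall_inP => y yW.
  by apply: connect_trans (rW y yW); rewrite connect_edge_rel_sym rW.
have /and3P[_ _ /acyclicP acG] := treeG.
apply/acyclicP => p p_gt2 /andP[pF pu]; apply: (acG p p_gt2).
rewrite /ucycle /ucycleb pu andbT; apply: sub_cycle pF => x y.
by move/(edge_relS (subsetT _)); rewrite edge_relT.
Qed.

(* Otherwise take an edge with the largest far side: it starts at [c], and its
   other end has weight at most that of [c]. *)
Lemma single_centroid_cut c a : centroid G = [set c] -> #|cut c a|.*2 < #|G|.
Proof.
move=> Ec; rewrite ltnNge; apply/negP => big_a.
case: (@arg_maxnP _ a xpredT (fun a => #|cut c a|) isT) => b _ amax.
have bmax e : #|cut c e| <= #|cut c b| by apply: amax.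
have big_b : #|G| <= #|cut c b|.*2.
  by apply: leq_trans big_a _; rewrite leq_double.
have [u ub [_ Eb]] := lowP c b; set w := low c b in Eb.
have Eu : u = c.
  apply: contraNeq ub => /low_surj[e Ee]; rewrite Ee.
  apply: contraT => eb; have := bmax e; rewrite leqNgt => /negP[].
  have eNb : e != b by apply: contraNneq eb => ->; rewrite low_cut.
  apply: proper_card; rewrite properE low_cut_sub -?low_cutE // .
  by rewrite -(cut_other_edge c Eb eNb) Ee low_cut.
subst u; have wNc : w != c := low_root c b.
suff : w \in centroid G by rewrite Ec in_set1 (negPf wNc).
have : c \in centroid G by rewrite Ec set11.
rewrite !in_set => /forallP cmin; apply/forallP => u.
have cb : c \in val b by rewrite Eb set21.
apply: leq_trans (cmin u); apply: leq_trans (weight_ge cb).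
(* Seen from [w], the far side of [b] is the complement of [cut c b], at most half of the tree; the
   far side of any other edge at [w] lies within [cut c b]. *)
apply: weight_le => e we; have [->|eNb] := eqVneq e b.
  by rewrite (cut_flip Eb) cardsCs setCK; lia.
have -> : cut c b = ~: cut w b by rewrite (cut_flip Eb) setCK.
apply: subset_leq_card.
have wb : w \in val b by rewrite Eb set22.
rewrite -disjoints_subset; apply: cut_disjoint.
  rewrite -(@edge_other_cut w b e w) ?root_cut //.
  by rewrite eq_sym.
by rewrite -(edge_other_cut _ eNb wb) root_cut.
Qed.

(** * Pendant edges and their partners *)

Lemma exists_leaf_cut r a :
  exists2 b, cut r b \subset cut r a & #|cut r b| = 1.
Proof.
pose Q := [pred b | cut r b \subset cut r a].
have Qa : Q a by apply: subxx.
case: (@arg_minnP _ a Q (fun b => #|cut r b|) Qa) => b /= ba bmin.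
exists b => //; apply/eqP; apply: contraT => b1.
have /card_gt0P[x] : 0 < #|cut r b :\ low r b|.
  have := cut_gt0 r b; move: b1.
  by rewrite (cardsD1 (low r b) (cut r b)) low_cut; lia.
case/setD1P=> xNb xb.
have xNr := cut_neq_root xb.
have [e Ex] := low_surj xNr; rewrite Ex in xb xNb.
have eNb : e != b by apply: contraNneq xNb => ->.
have eb := low_cut_sub xb.
have := bmin e (subset_trans eb ba); rewrite leqNgt => /negP[].
by apply: proper_card; rewrite properE eb -low_cutE low_cut_asym.
Qed.

(** A largest cut containing [x] is a whole branch at [r]. *)
Lemma exists_top_cut r x : x != r -> exists2 a, x \in cut r a &
  forall b, low r b \notin cut r a -> [disjoint cut r a & cut r b].
Proof.
case/low_surj => a0 ->; have x0 := low_cut r a0.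
pose Q := [pred a | low r a0 \in cut r a].
case: (@arg_maxnP _ a0 Q (fun a => #|cut r a|) x0) => a /= xa amax.
exists a => // b bNa; apply: cut_disjoint (bNa).
apply/negP => ab; have sab := low_cut_sub ab.
have := amax b (subsetP sab _ xa); rewrite leqNgt => /negP[].
apply: proper_card; rewrite properE sab; apply/subsetPn.
by exists (low r b); [exact: low_cut | exact: bNa].
Qed.

Lemma leaf_cutE r a : #|cut r a| = 1 -> cut r a = [set low r a].
Proof.
move/eqP/cards1P => [x Ex]; rewrite Ex; have := low_cut r a.
by rewrite Ex in_set1 => /eqP->.
Qed.

Lemma leaf_pair_cut r a b : #|cut r a| = 1 -> #|cut r b| = 1 -> b != a ->
  #|cut r a :|: cut r b| = 2.
Proof.
move=> /leaf_cutE-> /leaf_cutE-> bNa.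
by rewrite cards2 (inj_eq (@low_inj r)) eq_sym bNa.
Qed.

(* In a tree with more than 4 vertices and a single centroid [r], the edges with
   at least two partners are exactly the pendant edges: another partner of a
   pendant edge is a pendant edge or the edge cutting off a path of two
   vertices, while an edge cutting off more than one vertex has at most one. *)
Definition partners r a :=
  [set b | (b != a) && (#|cut r a :|: cut r b| == 2)].

Lemma leaf_partners r a : (forall b, #|cut r b|.*2 < #|G|) -> 4 < #|G| ->
  #|cut r a| = 1 -> 1 < #|partners r a|.
Proof.
move=> small n_gt4 a1; have Ea := leaf_cutE a1; pose v := low r a.
have [t vt topt] := exists_top_cut (low_root r a).
(* The branch [t] of [v] has fewer than half of the vertices, so another branch exists; it provides
   the first partner [b1]. *)
have [x] : exists x, x \notin r |: cut r t.
  by apply: ex_notin; have := small t; rewrite cardsU1 root_cut; lia.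
rewrite in_setU1 negb_or => /andP[/low_surj[e ->] et].
have [b1 b1e b11] := exists_leaf_cut r e.
have dis1 : [disjoint cut r t & cut r b1] := disjointWr b1e (topt e et).
have vb1 : v \notin cut r b1 by rewrite (disjointFr dis1 vt).
have leafP b : #|cut r b| = 1 -> v \notin cut r b -> b \in partners r a.
  move=> b1P vb; have bNa : b != a.
    by apply: contraNneq vb => ->; apply: low_cut.
  by rewrite in_set bNa leaf_pair_cut.
apply/card_gt1P; have [ta|tNa] := eqVneq t a.
  (* If [a] alone is a branch, then [r], [v] and the branch [s] of [b1] do not exhaust the tree, and
     a third branch contains [b2]. *)
  subst t; have [s ws tops] := exists_top_cut (low_root r b1).
  have [y] : exists y, y \notin r |: (v |: cut r s).
    apply: ex_notin; move: (small s) n_gt4.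
    by rewrite cardsU1 (cardsU1 v); do 2!case: (_ \notin _); clear; lia.
  rewrite !in_setU1 !negb_or => /and3P[/low_surj[d ->] dv ds].
  have [b2 b2d b21] := exists_leaf_cut r d.
  have da : low r d \notin cut r a by rewrite Ea in_set1.
  have vb2 : v \notin cut r b2.
    by rewrite (disjointFr (disjointWr b2d (topt d da)) vt).
  exists b1, b2; split; [exact: leafP | exact: leafP |].
  apply: contraTneq (low_cut r b1) => {2}->.
  by rewrite (disjointFr (disjointWr b2d (tops d ds)) ws).
(* Otherwise let [s] be the edge just above [a]. If it cuts off two vertices, it is the second
   partner; if more, a pendant edge other than [a] lies below it. *)
pose Q := [pred e | (e != a) && (v \in cut r e)].
have Qt : Q t by rewrite /= tNa.
case: (@arg_minnP _ t Q (fun e => #|cut r e|) Qt) => s /andP[sNa vs] smin.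
have st : cut r s \subset cut r t.
  case/orP: (cut_laminar vs vt) => [/low_cut_sub //|ts].
  by have /eqP-> : cut r t == cut r s by rewrite eqEcard low_cut_sub ?smin.
have vNs : v != low r s by rewrite (inj_eq (@low_inj r)) eq_sym.
have [s2|s2] := eqVneq #|cut r s| 2.
  exists b1, s; split; first exact: leafP.
    rewrite in_set sNa; have /setUidPr-> : cut r a \subset cut r s.
      exact: low_cut_sub.
    by rewrite s2.
  by apply: contraNneq vb1 => ->.
have [y] : exists y, y \in cut r s :\: [set v; low r s].
  have sub_s : [set v; low r s] \subset cut r s.
    by apply/subsetP => z /set2P[]->; [exact: vs | exact: low_cut].
  have := subset_leq_card sub_s; rewrite cards2 vNs => s_ge2.
  apply/card_gt0P; rewrite cardsD (setIidPr sub_s) cards2 vNs subn_gt0.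
  by rewrite ltn_neqAle eq_sym s2; exact: s_ge2.
rewrite in_setD in_set2 negb_or => /andP[/andP[yv ys] yis].
have [d Ey] := low_surj (cut_neq_root yis); rewrite Ey in yv ys yis.
have [b2 b2d b21] := exists_leaf_cut r d.
have ds : d != s by apply: contraNneq ys => ->.
have vd : v \notin cut r d.
  apply/negP => vd; have Qd : Q d.
    by rewrite /= vd andbT; apply: contraNneq yv => ->.
  have := smin d Qd; rewrite leqNgt => /negP[]; apply: proper_card.
  by rewrite properE low_cut_sub // -low_cutE low_cut_asym.
exists b1, b2; split; [exact: leafP | |].
  by apply: (leafP _ b21); apply: contraNN vd; exact: (subsetP b2d).
have b2t : cut r b2 \subset cut r t.
  exact: subset_trans (subset_trans b2d (low_cut_sub yis)) st.
have lt : low r b2 \in cut r t by apply: (subsetP b2t); exact: low_cut.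
apply: contraTneq (low_cut r b2) => {2}<-.
by rewrite (disjointFr dis1 lt).
Qed.

(** If [cut r a] had at least two vertices, each partner would have the cut [cut r a :\ low r a],
    but distinct edges have distinct cuts. *)
Lemma partners_leaf r a : 1 < #|partners r a| -> #|cut r a| = 1.
Proof.
case/card_gt1P=> b1 [b2 [P1 P2 b12]].
apply/eqP; apply: contraT => a1.
have a2 : 1 < #|cut r a| by have := cut_gt0 r a; lia.
have Pcut b : b \in partners r a -> cut r b = cut r a :\ low r a.
  rewrite in_set => /andP[bNa /eqP Eu].
  have EU : cut r a = cut r a :|: cut r b.
    by apply/eqP; rewrite eqEcard subsetUl Eu.
  have ba : cut r b \subset cut r a by rewrite EU subsetUr.
  have lb : low r a \notin cut r b by rewrite low_cut_asym // low_cutE.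
  apply/eqP; rewrite eqEcard subsetD1 ba lb /=.
  have := cardsD1 (low r a) (cut r a); rewrite low_cut {1}EU Eu => -[].
  by have := cut_gt0 r b; lia.
have E12 : cut r b1 = cut r b2 by rewrite (Pcut _ P1) (Pcut _ P2).
have l1 : low r b1 \in cut r b2 by rewrite -E12; apply: low_cut.
have := low_cut_asym b12 l1; rewrite E12 => /negP[]; exact: low_cut.
Qed.

(** * Reading the size of a union of two cuts from the partition *)

(* The component of [c] is the only one that may have more than half of the
   vertices, and it is the complement of the two far sides. *)
Lemma theta_cut c a b k : (forall e, #|cut c e|.*2 < #|G|) -> k.*2 < #|G| ->
  (#|G| - k \in theta [set a; b]) = (#|cut c a :|: cut c b| == k).
Proof.
move=> small k_small; rewrite mem_sort.
pose cls x := [set y | ((x \in cut c a) == (y \in cut c a)) &&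
                       ((x \in cut c b) == (y \in cut c b))].
have compE x :
    [set y in [set: G] | connect (edge_rel (~: [set a; b])) x y] = cls x.
  apply/setP => y; rewrite !in_set /= (connect_cut c).
  apply/forall_inP/andP => [H|[Ha Hb] e /set2P[]-> //].
  by split; apply: H; rewrite ?set21 ?set22.
have comp0 x : x \notin cut c a -> x \notin cut c b ->
    cls x = ~: (cut c a :|: cut c b).
  move=> /negPf xa /negPf xb; apply/setP => y; rewrite in_set xa xb.
  by rewrite in_setC in_setU negb_or ![false == _]eq_sym !eqbF_neg.
apply/mapP/eqP => [[C]|<-].
  rewrite mem_enum => /imsetP[x _ ->]; rewrite compE => EC.
  (* A class inside a cut has fewer than half of the vertices, whereas [#|G| - k] is more than
     half. *)
  have xa : x \notin cut c a.
    apply/negP => xa; have := small a; move: k_small.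
    have /subset_leq_card : cls x \subset cut c a.
      by apply/subsetP => y; rewrite in_set xa => /andP[/eqP<-].
    by rewrite -EC; clear; lia.
  have xb : x \notin cut c b.
    apply/negP => xb; have := small b; move: k_small.
    have /subset_leq_card : cls x \subset cut c b.
      by apply/subsetP => y; rewrite in_set xb => /andP[_ /eqP<-].
    by rewrite -EC; clear; lia.
  move: EC; rewrite (comp0 x xa xb) cardsCs setCK.
  have := max_card (mem (cut c a :|: cut c b)); move: k_small; clear; lia.
exists (~: (cut c a :|: cut c b)); last by rewrite [RHS]cardsCs setCK.
rewrite mem_enum; apply/imsetP; exists c; first exact: in_setT.
by rewrite compE comp0 ?root_cut.
Qed.

End Tree.

(** * Transfer of cut sizes between two trees *)

Section TwoTrees.
Variables (T T' : sgraph) (treeT : is_tree T) (treeT' : is_tree T').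
Variables (c : T) (c' : T') (f : edge T -> edge T') (f_inj : injective f).
Hypothesis eq_card : #|T| = #|T'|.
Hypothesis small : forall a, #|cut c a|.*2 < #|T|.
Hypothesis small' : forall a, #|cut c' a|.*2 < #|T'|.
Hypothesis f_cut : forall a b k, a != b -> k.*2 < #|T| ->
  (#|cut c' (f a) :|: cut c' (f b)| == k) = (#|cut c a :|: cut c b| == k).

Lemma leaf_cut_map a : #|cut c a| = 1 -> #|cut c' (f a)| = 1.
Proof.
move=> a1; have [n_le4|n_gt4] := leqP #|T| 4.
  (* With at most 4 vertices, a cut with fewer than half of them is a single vertex. *)
  have := small' (f a); have := cut_gt0 treeT' c' (f a).
  by rewrite -eq_card; lia.
have /card_gt1P[b1 [b2 [P1 P2 b12]]] := leaf_partners treeT small n_gt4 a1.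
have Pf b : b \in partners c a -> f b \in partners c' (f a).
  rewrite !in_set => /andP[bNa Ub]; rewrite (inj_eq f_inj) bNa /=.
  by rewrite f_cut 1?eq_sym //; lia.
apply: (partners_leaf treeT'); apply/card_gt1P; exists (f b1), (f b2).
by split; [exact: Pf | exact: Pf | rewrite (inj_eq f_inj)].
Qed.

(* For [b] a pendant edge beyond [a], [cut c a] is the union seen by the pair
   [a], [b], and the corresponding union in [T'] contains [cut c' (f a)]. *)
Lemma card_cut_map_le a : #|cut c' (f a)| <= #|cut c a|.
Proof.
have [a1|a1] := eqVneq #|cut c a| 1; first by rewrite a1 leaf_cut_map.
have [b ba b1] := exists_leaf_cut treeT c a.
have aNb : a != b by apply: contraNneq a1 => ->; rewrite b1.
have := f_cut aNb (small a); rewrite (setUidPl ba) eqxx => /eqP <-.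
by rewrite subset_leq_card ?subsetUl.
Qed.

End TwoTrees.

Theorem theorem5p8 (T T' : sgraph) (treeT : is_tree T) (treeT' : is_tree T')
  (cT : single_centroid T) (cT' : single_centroid T')
  (f : edge T -> edge T') (f_bij : bijective f)
  (f_theta : forall e e' : edge T, e != e' ->
     theta [set f e; f e'] = theta [set e; e']) :
  isomorphic T T'.
Proof.
have [g fK gK] := f_bij.
have f_inj := can_inj fK; have g_inj := can_inj gK.
have n_eq : #|T| = #|T'|.
  by rewrite (card_tree treeT) (card_tree treeT') (bij_eq_card f_bij).
have /cards1P[c Ec] : #|centroid T| == 1 by apply/eqP.
have /cards1P[c' Ec'] : #|centroid T'| == 1 by apply/eqP.
have small a : #|cut c a|.*2 < #|T| by exact: single_centroid_cut.
have small' a : #|cut c' a|.*2 < #|T'| by exact: single_centroid_cut.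
have f_cut : forall (a b : edge T) k, a != b -> k.*2 < #|T| ->
    (#|cut c' (f a) :|: cut c' (f b)| == k) = (#|cut c a :|: cut c b| == k).
  move=> a b k aNb k_small; have k_small' : k.*2 < #|T'| by rewrite -n_eq.
  rewrite -(theta_cut treeT a b small k_small) n_eq.
  by rewrite -(theta_cut treeT' (f a) (f b) small' k_small') f_theta.
(* The inverse of [f] satisfies the same hypotheses, so the inequality between cut sizes holds in
   both directions. *)
have g_cut : forall (a b : edge T') k, a != b -> k.*2 < #|T'| ->
    (#|cut c (g a) :|: cut c (g b)| == k) = (#|cut c' a :|: cut c' b| == k).
  move=> a b k aNb k_small; rewrite -f_cut ?gK ?n_eq //.
  by rewrite (inj_eq g_inj).
have card_cut a : #|cut c' (f a)| = #|cut c a|.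
  apply/eqP; rewrite eqn_leq (card_cut_map_le treeT treeT' f_inj) //=.
  rewrite -{1}(fK a).
  exact: (card_cut_map_le treeT' treeT g_inj (esym n_eq) small' small g_cut).
have sub_cut a b :
    (cut c' (f a) \subset cut c' (f b)) = (cut c a \subset cut c b).
  have [->|aNb] := eqVneq a b; first by rewrite !subxx.
  by rewrite !subset_cardsU card_cut f_cut.
(* The default value serves exactly one vertex: [c], which is no lower end, goes to [c']. *)
pose h x := if [pick a | low c a == x] is Some a then low c' (f a) else c'.
have hP x a : (h x \in cut c' (f a)) = (x \in cut c a).
  rewrite /h; case: pickP => [b /eqP <-|none].
    by rewrite !low_cutE.
  have [->|/(low_surj treeT)[b Ex]] := eqVneq x c.
    by rewrite !(negPf (root_cut _ _)).
  by have := none b; rewrite Ex eqxx.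
have h_inj : injective h.
  by move=> x y Exy; apply: (cut_inj treeT (r := c)) => a; rewrite -!hP Exy.
exists h; first by apply: inj_card_bij => //; rewrite n_eq.
move=> x y; rewrite (adj_cut treeT' c') (adj_cut treeT c).
(* By [hP], [f] maps the edges separating [x] from [y] onto those separating [h x] from [h y]. *)
rewrite -(card_imset _ f_inj); congr (#|pred_of_set _| == 1); apply/setP => a.
rewrite -(gK a) (mem_imset _ _ f_inj) !in_set /=.
by rewrite !hP.
Qed.
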